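(* Let $\tau=\{P_1,\dots,P_k\}$ be a signature in which every $P_i$ is a unary relation symbol. Then every class of finite structures of signature $\tau$ is decided by a non-adaptive left $2^k$-query algorithm over $\mathbb{N}$.
   Context: Structures are finite relational structures with non-empty domain; classes of structures are closed under isomorphism. $\hom(F,D)$ is the number of homomorphisms from $F$ to $D$. A non-adaptive left $m$-query algorithm over $\mathbb{N}$ is a pair $((F_1,\dots,F_m),X)$ with $F_i$ finite structures of signature $\tau$ and $X\subseteq\mathbb{N}^m$; it decides the class $\{D:(\hom(F_1,D),\dots,\hom(F_m,D))\in X\}$. *)

(* Defs.v *)
From mathcomp Require Import all_boot.

Set Implicit Arguments.
Unset Strict Implicit.
Unset Printing Implicit Defensive.

Record signature := Signature {
  symbol : finType;
  arity : symbol -> nat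
}.

Record structure (tau : signature) := Structure {
  dom :> finType;
  dom_nonempty : 0 < #|dom|;
  interp : forall P : symbol tau, {set (arity P).-tuple dom}
}.

Definition is_hom (tau : signature) (F D : structure tau) (h : {ffun F -> D})
    : bool :=
  [forall P : symbol tau, forall t : (arity P).-tuple F,
    (t \in interp F P) ==> (map_tuple h t \in interp D P)].

Definition hom (tau : signature) (F D : structure tau) : nat :=
  #|[set h : {ffun F -> D} | is_hom h]|.

Definition isomorphic (tau : signature) (A B : structure tau) : Prop :=
  exists2 h : A -> B, bijective h &
    forall (P : symbol tau) (t : (arity P).-tuple A),
      (t \in interp A P) = (map_tuple h t \in interp B P).

Definition iso_closed (tau : signature) (C : structure tau -> Prop) : Prop :=
  forall A B : structure tau, isomorphic A B -> C A -> C B.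

(* Non-adaptive left m-query algorithms over the natural numbers. The queries
   are a family over 'I_m because structure tau lives in too large a universe
   for m.-tuple. The set of accepted answers is an arbitrary, possibly
   undecidable, subset of nat^m, hence a Prop-valued predicate. *)
Record left_query_algorithm (tau : signature) (m : nat) := LeftQueryAlgorithm {
  query : 'I_m -> structure tau;
  accepted : m.-tuple nat -> Prop
}.

Definition decides (tau : signature) (m : nat)
    (A : left_query_algorithm tau m) (C : structure tau -> Prop) : Prop :=
  forall D : structure tau,
    C D <-> accepted A [tuple hom (query A i) D | i < m].

(* Main.v *)
(* Call the set of predicates that hold at an element its colour. For a set S of
   predicates, the homomorphisms into D from the one-point structure of colour S
   are the elements of D whose colour contains S. The 2^k numbers obtained in
   this way determine, by downward induction on S, how many elements have
   colour exactly S, and these multiplicities determine D up to isomorphism. *)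
Require Import Defs.
From mathcomp Require Import all_boot.

Set Implicit Arguments.
Unset Strict Implicit.
Unset Printing Implicit Defensive.

(** Uniqueness in Möbius inversion on the subset lattice. Strict supersets of [S] have smaller
    complements, so by induction their terms agree and cancel, leaving [a S = b S]. *)
Lemma eq_from_sum_supersets (T : finType) (a b : {set T} -> nat) :
    (forall S : {set T}, \sum_(U : {set T} | S \subset U) a U =
      \sum_(U : {set T} | S \subset U) b U) ->
  a =1 b.
Proof.
move=> eq_sum S; have [n] := ubnP #|~: S|.
elim: n S => // n IHn S; rewrite ltnS => leSn.
have := eq_sum S; rewrite (bigD1 S) // [in RHS](bigD1 S) //=.
rewrite (eq_bigr b) => [/addIn // | U /andP[sSU neqUS]].
apply/IHn/(leq_trans _ leSn)/proper_card.
rewrite properE !setCS sSU; apply: contra neqUS => sUS.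
by rewrite eqEsubset sUS.
Qed.

Section FiberMatch.

Variable K : eqType.

(** Pairs the fibres of [f] and [g] over each value in enumeration order. If these fibres have equal
    sizes, the index is in range and the default [b0] is never reached. *)
Definition fiber_match (A B : finType) (f : A -> K) (g : B -> K) (b0 : B)
    (x : A) : B :=
  nth b0 (enum [pred y | g y == f x]) (index x (enum [pred y | f y == f x])).

Variables (A B : finType) (f : A -> K) (g : B -> K).
Hypothesis eq_fibers :
  forall c, #|[pred x | f x == c]| = #|[pred y | g y == c]|.

Lemma index_fiber_lt x :
  index x (enum [pred y | f y == f x]) < size (enum [pred y | g y == f x]).
Proof.
by rewrite -cardE -eq_fibers cardE index_mem mem_enum inE.
Qed.

Lemma fiber_matchE b0 x : g (fiber_match f g b0 x) = f x.
Proof.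
by have := mem_nth b0 (index_fiber_lt x); rewrite mem_enum inE => /eqP.
Qed.

Lemma fiber_matchK a0 b0 :
  cancel (fiber_match f g b0) (fiber_match g f a0).
Proof.
(* The image of [x] lies over the same value [f x], so the way back uses the same two enumerations,
   with their roles exchanged. *)
move=> x; rewrite {1}/fiber_match fiber_matchE.
rewrite index_uniq ?index_fiber_lt ?enum_uniq //.
by rewrite nth_index // mem_enum inE.
Qed.

End FiberMatch.

Section UnarySignature.

Variable tau : signature.
Hypothesis unary_tau : forall P : symbol tau, arity P = 1.

(** [arity P] equals 1 only propositionally; [nseq_tuple (arity P) d] has the required type without
    a transport. *)
Definition colour (D : structure tau) (d : D) : {set symbol tau} :=
  [set P | nseq_tuple (arity P) d \in interp D P].

Lemma unary_tupleP (T : Type) (P : symbol tau) (t : (arity P).-tuple T) :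
  exists x, t = nseq_tuple (arity P) x.
Proof.
move: t; rewrite unary_tau => t.
by exists (thead t); apply: val_inj; case/tupleP: t => x t; rewrite tuple0.
Qed.

Lemma map_nseq_tuple (T U : Type) (h : T -> U) n x :
  map_tuple h (nseq_tuple n x) = nseq_tuple n (h x).
Proof. by apply: val_inj; rewrite /= map_nseq. Qed.

Lemma isomorphic_from_colour (A B : structure tau) (h : A -> B) :
  bijective h -> (forall a, colour (h a) = colour a) -> isomorphic A B.
Proof.
move=> bij_h colour_h; exists h => // P t.
have [x ->] := unary_tupleP t; rewrite map_nseq_tuple.
by have /setP/(_ P) := colour_h x; rewrite !inE.
Qed.

Lemma isomorphic_from_card_colour (A B : structure tau) :
    (forall S, #|[pred a : A | colour a == S]|
             = #|[pred b : B | colour b == S]|) ->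
  isomorphic A B.
Proof.
move=> eqAB.
have /card_gt0P[a0 _] := dom_nonempty A.
have /card_gt0P[b0 _] := dom_nonempty B.
apply: (@isomorphic_from_colour _ _
  (fiber_match (@colour A) (@colour B) b0)) => [|a].
  exists (fiber_match (@colour B) (@colour A) a0); exact: fiber_matchK.
exact: fiber_matchE.
Qed.

Lemma card_unit_gt0 : 0 < #|{: unit}|.
Proof. by rewrite card_unit. Qed.

Definition point (S : {set symbol tau}) : structure tau :=
  Structure card_unit_gt0 (fun P => [set t | P \in S]).

Lemma is_hom_point S (D : structure tau) (h : {ffun point S -> D}) :
  is_hom h = (S \subset colour (h tt)).
Proof.
apply/forallP/subsetP => [homh P PS | sub P].
  have /forallP/(_ (nseq_tuple (arity P) tt)) := homh P.
  by rewrite map_nseq_tuple !inE PS.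
apply/forallP => t; apply/implyP; have [[] ->] := unary_tupleP t.
by rewrite inE map_nseq_tuple => /sub; rewrite inE.
Qed.

Lemma hom_point S (D : structure tau) :
  hom (point S) D = #|[pred d : D | S \subset colour d]|.
Proof.
pose const (d : D) : {ffun point S -> D} := [ffun=> d].
have const_inj : injective const.
  by move=> d e /ffunP/(_ tt); rewrite !ffunE.
rewrite -(card_image const_inj) /hom; apply: eq_card => h.
rewrite inE is_hom_point; apply/idP/imageP => [sub | [d sub ->]].
  by exists (h tt) => //; apply/ffunP => -[]; rewrite ffunE.
by rewrite ffunE.
Qed.

(** Sorting the elements by exact colour gives the superset sums that [eq_from_sum_supersets]
    inverts. *)
Lemma hom_point_sum S (D : structure tau) :
  hom (point S) D =
    \sum_(U : {set symbol tau} | S \subset U) #|[pred d : D | colour d == U]|.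
Proof.
rewrite hom_point -sum1_card.
rewrite (partition_big (@colour D)
  [pred U : {set symbol tau} | S \subset U]) //=.
apply: eq_bigr => U sSU; rewrite -sum1_card; apply: eq_bigl => d.
by rewrite !inE andb_idl // => /eqP ->.
Qed.

Lemma isomorphic_from_hom_point (A B : structure tau) :
  (forall S, hom (point S) A = hom (point S) B) -> isomorphic A B.
Proof.
move=> eq_hom; apply: isomorphic_from_card_colour.
by apply: eq_from_sum_supersets => S; rewrite -!hom_point_sum.
Qed.

End UnarySignature.

Theorem theorem38 (k : nat) (tau : signature)
    (card_tau : #|symbol tau| = k)
    (unary_tau : forall P : symbol tau, arity P = 1)
    (C : structure tau -> Prop) (C_iso : iso_closed C) :
  exists A : left_query_algorithm tau (2 ^ k), decides A C.
Proof.
have card_sets : #|{set symbol tau}| = 2 ^ k.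
  by rewrite -cardsT -powersetT card_powerset cardsT card_tau.
pose q (i : 'I_(2 ^ k)) := point (enum_val (cast_ord (esym card_sets) i)).
(* Accept exactly the answer vectors realised by members of [C]. A structure with an accepted vector
   then shares it with some member of [C], and the two are isomorphic. *)
exists (LeftQueryAlgorithm q (fun v =>
  exists2 D, C D & [tuple hom (q i) D | i < 2 ^ k] = v)) => D.
split=> [CD | [D' CD' eq_homs]]; first by exists D.
apply: C_iso CD'; apply: isomorphic_from_hom_point => // S.
(* Equality of the vectors is read off at the coordinate whose query is [point S]. *)
have /= := congr1 (fun t => tnth t (cast_ord card_sets (enum_rank S))) eq_homs.
by rewrite !tnth_mktuple /q cast_ordK enum_rankK.
Qed.
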